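(* Consider the one-dimensional Maxwell--Debye finite difference scheme of Young (coupling the variables $B$, $E$, $P$), with parameters $\epsilon_0,\mu_0,\epsilon_\infty,t_r,\delta t,\delta x>0$ and $\epsilon_s\ge\epsilon_\infty$, and let $c_\infty=1/\sqrt{\epsilon_0\epsilon_\infty\mu_0}$. The scheme is stable under the following condition: (i) if $\epsilon_s>\epsilon_\infty$: $\ \delta t\le \min(\delta x/c_\infty,\,2t_r)$; (ii) if $\epsilon_s=\epsilon_\infty$: $\ \delta t< \delta x/c_\infty$.
   Context: The scheme is, for $j,n$ integers, $$\tfrac1{\delta t}(B_{j+1/2}^{n+1/2}-B_{j+1/2}^{n-1/2})=-\tfrac1{\delta x}(E_{j+1}^n-E_j^n),\qquad \tfrac{\epsilon_0\epsilon_\infty}{\delta t}(E_j^{n+1}-E_j^n)=-\tfrac1{\mu_0\delta x}(B_{j+1/2}^{n+1/2}-B_{j-1/2}^{n+1/2})-J_j^{n+1/2},$$ $$t_r\frac{P_j^{n+1/2}-P_j^{n-1/2}}{\delta t}=-\frac{P_j^{n+1/2}+P_j^{n-1/2}}2+\epsilon_0(\epsilon_s-\epsilon_\infty)E_j^n,\qquad t_rJ_j^{n+1/2}=-P_j^{n+1/2}+\epsilon_0(\epsilon_s-\epsilon_\infty)\frac{E_j^{n+1}+E_j^n}2 .$$ Put $\lambda=c_\infty\delta t/\delta x$, $\delta=\delta t/(2t_r)$, $\alpha=\epsilon_s/\epsilon_\infty-1$ and, for $\xi\in\mathbb R$, $\sigma=\lambda(e^{i\xi}-1)$, $q=|\sigma|^2=4\lambda^2\sin^2(\xi/2)$;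 a star denotes complex conjugation. For plane waves $U_j^n=U^n e^{i\xi j}$ in the variable $U_j^n=(c_\infty B_{j+1/2}^{n-1/2},E_j^n,P_j^{n-1/2}/(\epsilon_0\epsilon_\infty))^t$ the scheme reads $U^{n+1}=G(\xi)U^n$ with amplification matrix $$G(\xi)=\begin{pmatrix}1&-\sigma&0\\ \frac{\sigma^*}{1+\delta\alpha}&\frac{(1+\delta)(1-\delta\alpha)+4\delta^2\alpha-(1+\delta)q}{(1+\delta)(1+\delta\alpha)}&\frac{1-\delta}{1+\delta}\,\frac{2\delta}{1+\delta\alpha}\\ 0&\frac{2\delta\alpha}{1+\delta}&\frac{1-\delta}{1+\delta}\end{pmatrix}.$$ Stability (in the sense of von Neumann) means: for every $\xi\in\mathbb R$, the sequence of powers $(G(\xi)^n)_{n\ge0}$ is bounded. *)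

(* Defs.v *)
From mathcomp Require Import all_boot all_order all_algebra.
From mathcomp Require Import reals trigo topology normedtype.
From mathcomp Require Import complex ring.

Set Implicit Arguments.
Unset Strict Implicit.
Unset Printing Implicit Defensive.

Import Order.TTheory GRing.Theory Num.Theory.
Import numFieldNormedType.Exports.
Local Open Scope ring_scope.
Local Open Scope complex_scope.

Record params (R : realType) := Params {
  eps0 : R; mu0 : R; eps_inf : R; eps_s : R; t_r : R; dt : R; dx : R
}.

Definition c_inf (R : realType) (p : params R) : R :=
  1 / Num.sqrt (eps0 p * eps_inf p * mu0 p).

(* The first index is time and the second is space.  Half-integer indices are
   shifted: E n j = E_j^n, B n j = B_{j+1/2}^{n-1/2}, P n j = P_j^{n-1/2},
   J n j = J_j^{n-1/2}.  The fields are complex-valued so as to admit plane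
   waves. *)
Definition young_scheme (R : realType) (p : params R)
    (B E P J : int -> int -> R[i]) : Prop :=
  forall n j : int,
  [/\ (1 / dt p)%:C * (B (n + 1) j - B n j)
        = - ((1 / dx p)%:C * (E n (j + 1) - E n j)),
      (eps0 p * eps_inf p / dt p)%:C * (E (n + 1) j - E n j)
        = - ((1 / (mu0 p * dx p))%:C * (B (n + 1) j - B (n + 1) (j - 1)))
          - J (n + 1) j,
      (t_r p)%:C * ((P (n + 1) j - P n j) / (dt p)%:C)
        = - ((P (n + 1) j + P n j) / 2)
          + (eps0 p * (eps_s p - eps_inf p))%:C * E n j
    & (t_r p)%:C * J (n + 1) j
        = - P (n + 1) j
          + (eps0 p * (eps_s p - eps_inf p))%:C * ((E (n + 1) j + E n j) / 2)].

Definition lam (R : realType) (p : params R) : R := c_inf p * dt p / dx p.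
Definition del (R : realType) (p : params R) : R := dt p / (2 * t_r p).
Definition alp (R : realType) (p : params R) : R := eps_s p / eps_inf p - 1.

Definition expi (R : realType) (x : R) : R[i] := cos x +i* sin x.

Definition sigma (R : realType) (p : params R) (xi : R) : R[i] :=
  (lam p)%:C * (expi xi - 1).

Definition q (R : realType) (p : params R) (xi : R) : R[i] :=
  `|sigma p xi| ^+ 2.

Definition mx33 (T : nmodType) (s : seq (seq T)) : 'M[T]_3 :=
  \matrix_(i, j) nth 0 (nth [::] s i) j.

(* Amplification matrix in the variable
   (c_inf B_{j+1/2}^{n-1/2}, E_j^n, P_j^{n-1/2} / (eps0 eps_inf))^T. *)
Definition amplification (R : realType) (p : params R) (xi : R) : 'M[R[i]]_3 :=
  let d : R[i] := (del p)%:C in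
  let a : R[i] := (alp p)%:C in
  let s := sigma p xi in
  mx33 [::
    [:: 1; - s; 0];
    [:: (Num.conj s) / (1 + d * a);
        ((1 + d) * (1 - d * a) + 4 * d ^+ 2 * a - (1 + d) * q p xi)
          / ((1 + d) * (1 + d * a));
        (1 - d) / (1 + d) * (2 * d / (1 + d * a))];
    [:: 0; 2 * d * a / (1 + d); (1 - d) / (1 + d)]].

(* The norm on matrices is the maximum of the moduli of the entries. *)
Definition von_neumann_stable (R : realType) (p : params R) : Prop :=
  forall xi : R, bounded_fun (fun n : nat => amplification p xi ^+ n).

Definition plane_wave (R : realType) (xi : R) (u : int -> R[i]) :
    int -> int -> R[i] :=
  fun n j => u n * expi (xi * j%:~R).

Lemma expiD (R : realType) (x y : R) : expi (x + y) = expi x * expi y.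
Proof. by rewrite /expi cosD sinD; simpc; rewrite [X in _ +i* X]addrC. Qed.

Lemma expi_neq0 (R : realType) (x : R) : expi x != 0.
Proof.
apply/eqP => -[c0 s0]; have := cos2Dsin2 x.
by rewrite c0 s0 !expr0n addr0 => /esym/eqP; rewrite oner_eq0.
Qed.

Lemma expiN (R : realType) (x : R) : expi (- x) = (expi x)^-1.
Proof.
apply: (mulfI (expi_neq0 x)); rewrite -expiD subrr divff ?expi_neq0 //.
by rewrite /expi cos0 sin0.
Qed.

Lemma conj_expi (R : realType) (x : R) : Num.conj (expi x) = expi (- x).
Proof. by rewrite /expi cosN sinN. Qed.

Lemma conj_real_complex (R : realType) (x : R) : Num.conj x%:C = x%:C.
Proof. by rewrite conj_Creal //; apply/complex_realP; exists x. Qed.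

Lemma plane_wave_step (F : fieldType)
    (e0 m ei es tr t h c w x b b' e e' r r' J : F) :
  let l := c * t / h in let d := t / (2 * tr) in let a := es / ei - 1 in
  2 != 0 :> F -> e0 != 0 -> ei != 0 -> tr != 0 -> t != 0 -> h != 0 ->
  c != 0 -> w != 0 -> x != 0 -> m = (c ^+ 2 * e0 * ei)^-1 ->
  1 + d != 0 -> 1 + d * a != 0 ->
  [/\ 1 / t * (b' / c * x - b / c * x)
        = - (1 / h * (e * (x * w) - e * x)),
      e0 * ei / t * (e' * x - e * x)
        = - (1 / (m * h) * (b' / c * x - b' / c * (x / w))) - J,
      tr * ((e0 * ei * r' * x - e0 * ei * r * x) / t)
        = - ((e0 * ei * r' * x + e0 * ei * r * x) / 2)
          + e0 * (es - ei) * (e * x)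
    & tr * J = - (e0 * ei * r' * x)
          + e0 * (es - ei) * ((e' * x + e * x) / 2)]
  <->
  J = tr^-1 * (- (e0 * ei * r' * x) + e0 * (es - ei) * ((e' * x + e * x) / 2))
  /\ [/\ b' = b - l * (w - 1) * e,
      e' = l * (w^-1 - 1) / (1 + d * a) * b
           + ((1 + d) * (1 - d * a) + 4 * d ^+ 2 * a
              - (1 + d) * (l * (w - 1) * (l * (w^-1 - 1))))
               / ((1 + d) * (1 + d * a)) * e
           + (1 - d) / (1 + d) * (2 * d / (1 + d * a)) * r
    & r' = 2 * d * a / (1 + d) * e + (1 - d) / (1 + d) * r].
Proof.
move=> l d a n2 ne0 nei ntr nt nh nc nw nx -> nd nda.
have nd' : 2 * tr + t != 0.
  apply: contraNneq nd => E; apply/eqP.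
  transitivity ((2 * tr + t) / (2 * tr)); last by rewrite E mul0r.
  by rewrite /d; field; rewrite ?n2 ?ntr.
have nda' : 2 * tr * ei + t * (es - ei) != 0.
  apply: contraNneq nda => E; apply/eqP.
  transitivity ((2 * tr * ei + t * (es - ei)) / (2 * tr * ei)); last by rewrite E mul0r.
  by rewrite /d /a; field; rewrite ?n2 ?ntr ?nei.
have iffk (k A B C D : F) : k != 0 -> A - B = k * (C - D) -> A = B <-> C = D.
  move=> nk E; split=> H; apply/eqP; rewrite -subr_eq0.
    by move/eqP: E; rewrite H subrr eq_sym mulf_eq0 (negPf nk).
  by rewrite E H subrr mulr0.
have E1 : 1 / t * (b' / c * x - b / c * x) = - (1 / h * (e * (x * w) - e * x))
   <-> b' = b - l * (w - 1) * e.
  apply: (iffk (x / (t * c))); first by rewrite !mulf_neq0 ?invr_eq0 ?mulf_neq0.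
  by rewrite /l; field; rewrite nt nc nh.
have E3 : tr * ((e0 * ei * r' * x - e0 * ei * r * x) / t)
        = - ((e0 * ei * r' * x + e0 * ei * r * x) / 2)
          + e0 * (es - ei) * (e * x)
   <-> r' = 2 * d * a / (1 + d) * e + (1 - d) / (1 + d) * r.
  apply: (iffk (e0 * ei * x * tr * (1 + d) / t)).
    by rewrite !mulf_neq0 ?invr_eq0.
  by rewrite /a /d; field; rewrite ?nt ?n2 ?ntr ?nei ?nd'.
have E4 : tr * J = - (e0 * ei * r' * x)
          + e0 * (es - ei) * ((e' * x + e * x) / 2)
   <-> J = tr^-1 * (- (e0 * ei * r' * x)
     + e0 * (es - ei) * ((e' * x + e * x) / 2)).
  apply: (iffk tr) => //; by field; rewrite ?ntr ?n2.
have E2 : J = tr^-1 * (- (e0 * ei * r' * x)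
     + e0 * (es - ei) * ((e' * x + e * x) / 2)) ->
   b' = b - l * (w - 1) * e ->
   r' = 2 * d * a / (1 + d) * e + (1 - d) / (1 + d) * r ->
   e0 * ei / t * (e' * x - e * x)
        = - (1 / ((c ^+ 2 * e0 * ei)^-1 * h)
               * (b' / c * x - b' / c * (x / w))) - J
   <-> e' = l * (w^-1 - 1) / (1 + d * a) * b
           + ((1 + d) * (1 - d * a) + 4 * d ^+ 2 * a
              - (1 + d) * (l * (w - 1) * (l * (w^-1 - 1))))
               / ((1 + d) * (1 + d * a)) * e
           + (1 - d) / (1 + d) * (2 * d / (1 + d * a)) * r.
  move=> -> -> ->.
  apply: (iffk (e0 * ei * x * (1 + d * a) / t)).
    by rewrite !mulf_neq0 ?invr_eq0.
  by rewrite /a /d /l; field;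
    rewrite !mulN1r ?nei ?ntr ?n2 ?nd' ?nda' ?nw ?nh ?nt ?nc ?ne0.
split.
  by case=> /E1 H1 H2 /E3 H3 /E4 H4; move/(E2 H4 H1 H3): H2.
by case=> H4 [H1 H2 H3]; split; [apply/E1|apply/(E2 H4 H1 H3)|apply/E3|apply/E4].
Qed.

(* On plane waves the scheme is exactly U^{n+1} = G(xi) U^n. *)
Lemma young_scheme_plane_wave (R : realType) (p : params R) (xi : R)
    (U : int -> 'cV[R[i]]_3) :
  0 < eps0 p -> 0 < mu0 p -> 0 < eps_inf p -> eps_inf p <= eps_s p ->
  0 < t_r p -> 0 < dt p -> 0 < dx p ->
  (exists J : int -> int -> R[i],
     young_scheme p
       (plane_wave xi (fun n => U n 0 0 / (c_inf p)%:C))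
       (plane_wave xi (fun n => U n 1 0))
       (plane_wave xi (fun n => (eps0 p * eps_inf p)%:C * U n 2 0))
       J)
  <-> forall n, U (n + 1) = amplification p xi *m U n.
Proof.
move=> e0p m0p eip eis trp tp hp.
have cp : 0 < c_inf p by rewrite /c_inf divr_gt0 ?sqrtr_gt0 ?mulr_gt0.
have c2 : mu0 p = (c_inf p ^+ 2 * eps0 p * eps_inf p)^-1.
  rewrite /c_inf expr_div_n expr1n sqr_sqrtr ?mulr_ge0 ?ltW //.
  by field; rewrite ?gt_eqF.
have nC (z : R) : 0 < z -> z%:C != 0.
  by move=> z0; rewrite (fmorph_eq0 (real_complex R)) gt_eqF.
have dp : 0 < del p by rewrite /del divr_gt0 ?mulr_gt0.
have ap : 0 <= alp p by rewrite /alp subr_ge0 ler_pdivlMr // mul1r.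
have RC : [/\ (lam p)%:C = (c_inf p)%:C * (dt p)%:C / (dx p)%:C,
  (del p)%:C = (dt p)%:C / (2 * (t_r p)%:C) &
  (alp p)%:C = (eps_s p)%:C / (eps_inf p)%:C - 1].
  by split; rewrite /lam /del /alp
    ?(rmorphB, rmorphM, fmorphV, rmorph1, rmorph_nat).
case: RC => RCl RCd RCa.
have sC : Num.conj (sigma p xi) = (lam p)%:C * ((expi xi)^-1 - 1).
  rewrite /sigma (rmorphM Num.conj) (rmorphB Num.conj) (rmorph1 Num.conj) /=.
  by rewrite conj_real_complex conj_expi expiN.
have qE : q p xi
    = (lam p)%:C * (expi xi - 1) * ((lam p)%:C * ((expi xi)^-1 - 1)).
  by rewrite /q normCK sC.
have one_d : 1 + (del p)%:C != 0.
  by rewrite -(rmorph1 (real_complex R)) -rmorphD; apply: nC; rewrite addr_gt0.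
have one_da : 1 + (del p)%:C * (alp p)%:C != 0.
  rewrite -(rmorph1 (real_complex R)) -rmorphM -rmorphD; apply: nC.
  by rewrite ltr_pwDl // mulr_ge0 // ltW.
have c2C : (mu0 p)%:C = ((c_inf p)%:C ^+ 2 * (eps0 p)%:C * (eps_inf p)%:C)^-1.
  by rewrite c2 !(fmorphV, rmorphM, rmorphXn).
pose Jv n (x : R[i]) : R[i] := (t_r p)%:C^-1 *
  (- ((eps0 p)%:C * (eps_inf p)%:C * U (n + 1) 2 0 * x) +
   (eps0 p)%:C * ((eps_s p)%:C - (eps_inf p)%:C) *
   ((U (n + 1) 1 0 * x + U n 1 0 * x) / 2)).
have mxP n : U (n + 1) = amplification p xi *m U n <->
  [/\ U (n + 1) 0 0 = U n 0 0 - sigma p xi * U n 1 0,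
      U (n + 1) 1 0 = amplification p xi 1 0 * U n 0 0
        + amplification p xi 1 1 * U n 1 0 + amplification p xi 1 2 * U n 2 0
    & U (n + 1) 2 0 = amplification p xi 2 1 * U n 1 0
        + amplification p xi 2 2 * U n 2 0].
  have row i : (amplification p xi *m U n) i 0
      = amplification p xi i 0 * U n 0 0
      + amplification p xi i 1 * U n 1 0 + amplification p xi i 2 * U n 2 0.
    rewrite mxE !big_ord_recl big_ord0 addr0 addrA.
    by congr (_ * U n _ 0 + _ * U n _ 0 + _ * U n _ 0);
      try congr (amplification p xi _ _); apply: val_inj.
  split=> [->|[h0 h1 h2]].
    rewrite !row; split=> //.
      by rewrite !mxE /= mul1r mul0r addr0 mulNr.
    by rewrite [amplification p xi 2 0]mxE /= mul0r add0r.
  apply/colP => i; rewrite row; case: i => -[|[|[|//]]] ?.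
  - rewrite (_ : Ordinal _ = 0); last exact: val_inj.
    by rewrite h0 !mxE /= mul1r mul0r addr0 mulNr.
  - by rewrite (_ : Ordinal _ = 1); last exact: val_inj.
  - rewrite (_ : Ordinal _ = 2); last exact: val_inj.
    by rewrite h2 [amplification p xi 2 0]mxE /= mul0r add0r.
have n2 : 2 != 0 :> R[i] by rewrite pnatr_eq0.
have step n x J0 (nx : x != 0) := @plane_wave_step R[i] (eps0 p)%:C (mu0 p)%:C
  (eps_inf p)%:C (eps_s p)%:C (t_r p)%:C (dt p)%:C (dx p)%:C (c_inf p)%:C
  (expi xi) x (U n 0 0) (U (n + 1) 0 0) (U n 1 0) (U (n + 1) 1 0) (U n 2 0)
  (U (n + 1) 2 0) J0 n2 (nC _ e0p) (nC _ eip) (nC _ trp) (nC _ tp) (nC _ hp)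
  (nC _ cp) (expi_neq0 _) nx c2C.
move: step; rewrite /= -RCl -RCd -RCa => step.
have {}step n x J0 (nx : x != 0) := step n x J0 nx one_d one_da.
have expS j : expi (xi * (j + 1)%:~R) = expi (xi * j%:~R) * expi xi.
  by rewrite intrD mulrDr mulr1 expiD.
have expP j : expi (xi * (j - 1)%:~R) = expi (xi * j%:~R) / expi xi.
  by rewrite intrD mulrDr mulrN1 expiD expiN.
have K1 : (1 / dt p)%:C = 1 / (dt p)%:C by rewrite rmorphM fmorphV rmorph1.
have K2 : (1 / dx p)%:C = 1 / (dx p)%:C by rewrite rmorphM fmorphV rmorph1.
have K3 : (eps0 p * eps_inf p / dt p)%:C
    = (eps0 p)%:C * (eps_inf p)%:C / (dt p)%:C by rewrite !rmorphM fmorphV.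
have K4 : (1 / (mu0 p * dx p))%:C = 1 / ((mu0 p)%:C * (dx p)%:C).
  by rewrite rmorphM fmorphV rmorph1 rmorphM.
have K5 : (eps0 p * eps_inf p)%:C = (eps0 p)%:C * (eps_inf p)%:C.
  by rewrite rmorphM.
have K6 : (eps0 p * (eps_s p - eps_inf p))%:C
    = (eps0 p)%:C * ((eps_s p)%:C - (eps_inf p)%:C) by rewrite rmorphM rmorphB.
split=> [[J HJ] n | H].
  have := HJ n 0; rewrite /plane_wave expS expP.
  rewrite K1 K2 K3 K4 K5 K6 => /(step _ _ _ (expi_neq0 _)).
  case=> _ [h0 h1 h2]; apply/mxP; split=> //.
  - by rewrite h1 !mxE /= sC qE.
  - by rewrite h2 !mxE.
exists (fun n j => Jv (n - 1) (expi (xi * j%:~R))) => n j.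
rewrite /plane_wave expS expP addrK.
rewrite K1 K2 K3 K4 K5 K6.
apply/(step _ _ _ (expi_neq0 _)); split; first by [].
have /mxP[h0 h1 h2] := H n; split=> //.
- by rewrite h1 !mxE /= sC qE.
- by rewrite h2 !mxE.
Qed.

(* Main.v *)
Require Import Defs.
From mathcomp Require Import all_boot all_order all_algebra.
From mathcomp Require Import reals.
From mathcomp Require Import trigo normedtype complex ring.

Set Implicit Arguments.
Unset Strict Implicit.
Unset Printing Implicit Defensive.

Import Order.TTheory GRing.Theory Num.Theory.
Local Open Scope ring_scope.

(** The scheme with [alpha > 0] has the discrete energy
    [|b - sigma e / 2|^2 + (1 - q / 4) |e|^2
       + ((1 + delta) |r^{n+1}|^2 + (1 - delta) |r^n|^2) / (2 alpha)],
    where [r^{n+1}] is a combination of [e^n] and [r^n].  One step changes it by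
    [- (1 - delta^2) / (4 delta alpha) |r^{n+2} - r^n|^2], so it does not
    increase when [delta <= 1].  When [q <= 4] it controls [r], then [e], since
    [2 delta alpha e^n = (1 + delta) r^{n+1} - (1 - delta) r^n], and then [b];
    no strict inequality is needed.
    If [alpha = 0], then [r^n = rho^n r^0] with [|rho| < 1].  Adding suitable
    multiples of [r] to [b] and [e] decouples the Yee scheme, which
    conserves [|b - sigma e / 2|^2 + (1 - q / 4) |e|^2]; this is positive
    definite as [q < 4]. *)

(** * Bounded scalar sequences *)

Definition norm_bounded (C : numDomainType) (u : nat -> C) :=
  exists M : C, forall n, `|u n| <= M.

Lemma norm_boundedD (C : numDomainType) (u v : nat -> C) :
  norm_bounded u -> norm_bounded v -> norm_bounded (fun n => u n + v n).
Proof.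
move=> [M uM] [N vN]; exists (M + N) => n.
by rewrite (le_trans (ler_normD _ _)) // lerD.
Qed.

Lemma norm_boundedZ (C : numDomainType) (c : C) (u : nat -> C) :
  norm_bounded u -> norm_bounded (fun n => c * u n).
Proof.
by move=> [M uM]; exists (`|c| * M) => n; rewrite normrM ler_wpM2l.
Qed.

Lemma norm_bounded_eq (C : numDomainType) (u v : nat -> C) :
  u =1 v -> norm_bounded u -> norm_bounded v.
Proof. by move=> uv [M uM]; exists M => n; rewrite -uv. Qed.

Lemma norm_bounded_succ (C : numDomainType) (u : nat -> C) :
  norm_bounded (fun n => u n.+1) -> norm_bounded u.
Proof.
move=> [M uM]; have M0 : 0 <= M := le_trans (normr_ge0 _) (uM 0%N).
by exists (`|u 0%N| + M) => -[|n]; rewrite ?lerDl // (le_trans (uM n)) ?lerDr.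
Qed.

(** Turns an energy bound into a bound on the modulus without square roots, through
    [x <= 1 + x ^+ 2]. *)
Lemma norm_bounded_sqr (C : numFieldType) (k K : C) (u : nat -> C) :
  0 < k -> (forall n, k * `|u n| ^+ 2 <= K) -> norm_bounded u.
Proof.
move=> k0 uK; exists (1 + K / k) => n.
have h1 : `|u n| ^+ 2 <= K / k by rewrite ler_pdivlMr // mulrC.
rewrite (le_trans _ (lerD (lexx 1) h1)) // -subr_ge0.
have -> : 1 + `|u n| ^+ 2 - `|u n| = ((1 - `|u n|) ^+ 2 + `|u n| ^+ 2 + 1) / 2.
  by field.
rewrite divr_ge0 // !addr_ge0 // ?[0 <= `|_| ^+ 2]exprn_ge0 //.
by rewrite real_exprn_even_ge0 // rpredB ?rpred1 ?normr_real.
Qed.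

(** * Energy identities for one time step *)

Section DebyeStep.
Variable C : numClosedFieldType.
Implicit Types d a s b e r : C.

Definition debye_E d a s b e r : C :=
  Num.conj s / (1 + d * a) * b
  + ((1 + d) * (1 - d * a) + 4 * d ^+ 2 * a - (1 + d) * `|s| ^+ 2)
      / ((1 + d) * (1 + d * a)) * e
  + (1 - d) / (1 + d) * (2 * d / (1 + d * a)) * r.

Definition debye_P d a e r : C := 2 * d * a / (1 + d) * e + (1 - d) / (1 + d) * r.

(** The leapfrog energy |e|^2 + Re(conj b * (b - s e)), which pairs [b] with its next value, after
    completing the square. *)
Definition yee_energy s b e : C :=
  `|b - s / 2 * e| ^+ 2 + (1 - `|s| ^+ 2 / 4) * `|e| ^+ 2.

Definition debye_energy d a s b e r : C :=
  yee_energy s b e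
  + ((1 + d) * `|debye_P d a e r| ^+ 2 + (1 - d) * `|r| ^+ 2) / (2 * a).

Lemma debye_energy_step d a s b e r :
  0 < d -> 0 < a ->
  let b1 := b - s * e in
  let e1 := debye_E d a s b e r in
  let r1 := debye_P d a e r in
  debye_energy d a s b1 e1 r1
  = debye_energy d a s b e r
    - (1 - d ^+ 2) / (4 * d * a) * `|debye_P d a e1 r1 - r| ^+ 2.
Proof.
move=> d0 a0 /=.
have dR : Num.conj d = d by rewrite conj_Creal // gtr0_real.
have aR : Num.conj a = a by rewrite conj_Creal // gtr0_real.
have nd : 1 + d != 0 by rewrite gt_eqF // addr_gt0.
have nda : 1 + d * a != 0 by rewrite gt_eqF // addr_gt0 // mulr_gt0.
have d_neq0 : d != 0 by rewrite gt_eqF.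
have a_neq0 : a != 0 by rewrite gt_eqF.
(* Once |z|^2 is written z * conj z, the claim is a rational identity in which [s], [b], [e], [r]
   and their conjugates are independent variables. *)
rewrite /debye_energy /yee_energy /debye_E /debye_P !normCK.
rewrite !(fmorphV, rmorphM, rmorphB, rmorphD, rmorphXn, rmorph1, rmorph_nat) /=.
rewrite dR aR !conjCK.
by field; rewrite nd nda d_neq0 a_neq0.
Qed.

Lemma yee_energy_step s b e :
  let b1 := b - s * e in
  yee_energy s b1 (e + Num.conj s * b1) = yee_energy s b e.
Proof.
rewrite /yee_energy !normCK.
rewrite !(fmorphV, rmorphM, rmorphB, rmorphD, rmorph_nat) /= !conjCK.
by field.
Qed.

Lemma yee_energy_ge s b e : (1 - `|s| ^+ 2 / 4) * `|e| ^+ 2 <= yee_energy s b e.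
Proof. by rewrite lerDr exprn_ge0. Qed.

Lemma yee_energy_ge_sqr s b e : `|s| ^+ 2 <= 4 ->
  `|b - s / 2 * e| ^+ 2 <= yee_energy s b e.
Proof.
move=> s4; rewrite lerDl mulr_ge0 ?exprn_ge0 // subr_ge0.
by rewrite ler_pdivrMr // mul1r.
Qed.

(** * Boundedness of the orbits *)

Lemma debye_orbit_bounded d a s (b e r : nat -> C) :
  0 < d -> d <= 1 -> 0 < a -> `|s| ^+ 2 <= 4 ->
  (forall n, b n.+1 = b n - s * e n) ->
  (forall n, e n.+1 = debye_E d a s (b n) (e n) (r n)) ->
  (forall n, r n.+1 = debye_P d a (e n) (r n)) ->
  [/\ norm_bounded b, norm_bounded e & norm_bounded r].
Proof.
move=> d0 d1 a0 s4 bS eS rS.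
pose F n := debye_energy d a s (b n) (e n) (r n).
have nd : 1 + d != 0 by rewrite gt_eqF // addr_gt0.
have FE n : F n = yee_energy s (b n) (e n)
    + ((1 + d) * `|r n.+1| ^+ 2 + (1 - d) * `|r n| ^+ 2) / (2 * a).
  by rewrite rS.
have F_le n : F n <= F 0%N.
  elim: n => // n; apply: le_trans.
  rewrite /F eS rS bS debye_energy_step // gerBl mulr_ge0 ?exprn_ge0 //.
  by rewrite divr_ge0 ?mulr_ge0 ?(ltW d0) ?(ltW a0) // subr_ge0 exprn_ile1 // ltW.
have a2 : 0 < (2 * a)^-1 by rewrite invr_gt0 mulr_gt0.
have pol n : 0 <= (1 - d) * `|r n| ^+ 2 by rewrite mulr_ge0 ?subr_ge0 ?exprn_ge0.
have pol1 n : 0 <= (1 + d) * `|r n| ^+ 2.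
  by rewrite mulr_ge0 ?exprn_ge0 // addr_ge0 // ltW.
have yee_ge0 n : 0 <= yee_energy s (b n) (e n).
  by apply: le_trans (yee_energy_ge_sqr _ _ s4); rewrite exprn_ge0.
have rB : norm_bounded r.
  (* The weight [1 - d] of [r n] vanishes at [d = 1], so the bound is read off the term in
     [r n.+1]. *)
  apply: norm_bounded_succ.
  apply: (@norm_bounded_sqr _ ((1 + d) / (2 * a)) (F 0%N)) => [|n].
    by rewrite mulr_gt0 // addr_gt0.
  rewrite (le_trans _ (F_le n)) // FE -[leLHS]add0r lerD // mulrAC.
  by rewrite ler_wpM2r ?lerDl // ltW.
have eB : norm_bounded e.
  have rSB : norm_bounded (fun n => r n.+1) by case: rB => M rM; exists M.
  (* Solving the recurrence of [r] for [e n] divides by [2 * d * a]; this is where [a] must be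
     nonzero. *)
  apply: norm_bounded_eq (norm_boundedD (norm_boundedZ ((1 + d) / (2 * d * a)) rSB)
    (norm_boundedZ (- ((1 - d) / (2 * d * a))) rB)) => n /=.
  by rewrite rS /debye_P; field; rewrite nd !gt_eqF.
split=> //.
have vB : norm_bounded (fun n => b n - s / 2 * e n).
  apply: (@norm_bounded_sqr _ 1 (F 0%N)) => // n.
  rewrite mul1r (le_trans _ (F_le n)) // FE (le_trans (yee_energy_ge_sqr _ _ s4)) //.
  by rewrite lerDl mulr_ge0 ?addr_ge0 // ltW.
apply: norm_bounded_eq (norm_boundedD vB (norm_boundedZ (s / 2) eB)) => n /=.
by rewrite subrK.
Qed.

Lemma yee_orbit_bounded s (b e : nat -> C) :
  `|s| ^+ 2 < 4 ->
  (forall n, b n.+1 = b n - s * e n) ->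
  (forall n, e n.+1 = e n + Num.conj s * b n.+1) ->
  norm_bounded b /\ norm_bounded e.
Proof.
move=> s4 bS eS; pose F n := yee_energy s (b n) (e n).
have FE n : F n = F 0%N by elim: n => // n <-; rewrite /F eS bS yee_energy_step.
have eB : norm_bounded e.
  apply: (@norm_bounded_sqr _ (1 - `|s| ^+ 2 / 4) (F 0%N)) => [|n].
    by rewrite subr_gt0 ltr_pdivrMr // mul1r.
  by rewrite -(FE n) yee_energy_ge.
split=> //.
have vB : norm_bounded (fun n => b n - s / 2 * e n).
  apply: (@norm_bounded_sqr _ 1 (F 0%N)) => // n.
  by rewrite mul1r -(FE n) yee_energy_ge_sqr // ltW.
apply: norm_bounded_eq (norm_boundedD vB (norm_boundedZ (s / 2) eB)) => n /=.
by rewrite subrK.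
Qed.

Lemma debye0_orbit_bounded d s (b e r : nat -> C) :
  0 < d -> `|s| ^+ 2 < 4 ->
  (forall n, b n.+1 = b n - s * e n) ->
  (forall n, e n.+1 = debye_E d 0 s (b n) (e n) (r n)) ->
  (forall n, r n.+1 = debye_P d 0 (e n) (r n)) ->
  [/\ norm_bounded b, norm_bounded e & norm_bounded r].
Proof.
move=> d0 s4 bS eS rS.
have d_neq0 : d != 0 by rewrite gt_eqF.
have d1_gt0 : 0 < 1 + d by rewrite addr_gt0.
have nd : 1 + d != 0 by rewrite gt_eqF.
have rB : norm_bounded r.
  exists `|r 0%N|; elim=> // n; apply: le_trans.
  rewrite rS /debye_P mulr0 !mul0r add0r normrM ler_piMl //.
  rewrite normrM normfV (gtr0_norm d1_gt0) ler_pdivrMr // mul1r.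
  by rewrite (le_trans (ler_normB _ _)) // normr1 gtr0_norm.
(* With [rho = (1 - d) / (1 + d)], [D] is [(1 + d)^2 ((1 - rho)^2 + q rho)]. *)
pose D := 4 * d ^+ 2 + `|s| ^+ 2 * (1 - d ^+ 2).
have D_neq0 : D != 0.
  (* In this form positivity is visible for [d > 1] too, since |s|^2 < 4. *)
  have -> : D = `|s| ^+ 2 + d ^+ 2 * (4 - `|s| ^+ 2) by rewrite /D; ring.
  by rewrite gt_eqF // ltr_wpDl ?exprn_ge0 // mulr_gt0 ?exprn_gt0 // subr_gt0.
(* Matching the coefficients of [r n] in the two Yee equations gives (1 - rho) x = s y and (1 - rho)
   y + rho (conj s) x = 2 d rho; these are the solutions. *)
pose y := 4 * d ^+ 2 * (1 - d) / D.
pose x := s * y * (1 + d) / (2 * d).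
have [bB eB] : norm_bounded (fun n => b n + x * r n) /\
               norm_bounded (fun n => e n + y * r n).
  apply: (@yee_orbit_bounded s) => // n.
    rewrite bS rS /debye_P /x; field.
    by rewrite nd d_neq0.
  rewrite bS eS rS /debye_P /debye_E /x /y.
  move: D_neq0; rewrite /D normCK => D_neq0; field.
  by rewrite ?nd ?d_neq0 ?D_neq0.
split=> //.
  apply: norm_bounded_eq (norm_boundedD bB (norm_boundedZ (- x) rB)) => n /=.
  by rewrite mulNr addrK.
apply: norm_bounded_eq (norm_boundedD eB (norm_boundedZ (- y) rB)) => n /=.
by rewrite mulNr addrK.
Qed.

End DebyeStep.

(** * From scalar orbits to powers of the amplification matrix *)

Lemma bounded_fun_mx (K : numFieldType) (m n : nat) (A : nat -> 'M[K]_(m, n)) :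
  (forall i j, norm_bounded (fun k => A k i j)) -> bounded_fun A.
Proof.
move=> AB; have /boolp.choice[M AM] : forall ij : 'I_m * 'I_n,
    exists M, forall k, `|A k ij.1 ij.2| <= M by case=> i j; exact: AB.
have M0 ij : 0 <= M ij := le_trans (normr_ge0 _) (AM ij 0%N).
(* The sum of the entrywise bounds dominates each of them, hence the maximum norm. *)
exists (\sum_ij M ij); split=> [|N /ltW M_le k _ /=]; first exact/ger0_real/sumr_ge0.
apply: le_trans M_le; rewrite [leLHS]/Num.norm /=.
have [->|/mx_norm_neq0[ij ->]] := eqVneq (mx_norm (A k)) 0; first exact: sumr_ge0.
by rewrite (le_trans (AM ij k)) // (bigD1 ij) //= lerDl sumr_ge0.
Qed.

Lemma mulmx33E (S : pzSemiRingType) (A B : 'M[S]_3) i j :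
  (A *m B) i j = A i 0 * B 0 j + A i 1 * B 1 j + A i 2 * B 2 j.
Proof.
rewrite mxE !big_ord_recl big_ord0 addr0 addrA.
by congr (_ * B _ j + A i _ * B _ j + A i _ * B _ j); apply: val_inj.
Qed.

Lemma expi_norm (R : realType) (x : R) : `|expi x| = 1.
Proof.
apply/eqP; rewrite -sqrp_eq1 // normCK conj_expi -expiD subrr.
by rewrite /expi cos0 sin0.
Qed.

(** By the triangle inequality |e^(i xi) - 1| <= 2. Hence q <= 4 when lambda <= 1, strictly when
    lambda < 1. *)
Lemma sigma_norm_le (R : realType) (p : params R) (xi : R) :
  0 <= lam p -> `|sigma p xi| ^+ 2 <= 4 * (lam p)%:C%C ^+ 2.
Proof.
move=> l0; have lC0 : 0 <= (lam p)%:C%C by rewrite ler0c.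
rewrite /sigma normrM exprMn (ger0_norm lC0) mulrC ler_wpM2r ?exprn_ge0 //.
have -> : 4 = 2 ^+ 2 :> R[i] by rewrite -natrX.
rewrite ler_pXn2r ?nnegrE // (le_trans (ler_normB _ _)) //.
by rewrite expi_norm normr1.
Qed.

Section AmplificationOrbits.
Variables (R : realType) (p : params R) (xi : R).
Let A := amplification p xi.
Let d : R[i] := (del p)%:C%C.
Let a : R[i] := (alp p)%:C%C.

Lemma amplification_orbit j n :
  [/\ (A ^+ n.+1) 0 j = (A ^+ n) 0 j - sigma p xi * (A ^+ n) 1 j,
      (A ^+ n.+1) 1 j
        = debye_E d a (sigma p xi) ((A ^+ n) 0 j) ((A ^+ n) 1 j) ((A ^+ n) 2 j)
    & (A ^+ n.+1) 2 j = debye_P d a ((A ^+ n) 1 j) ((A ^+ n) 2 j)].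
Proof.
rewrite exprS !mulmx33E; split; rewrite {1 3 5}/A !mxE /=.
- by rewrite mul1r mul0r addr0 mulNr.
- by [].
- by rewrite mul0r add0r.
Qed.

(** As [A ^+ n.+1 = A * A ^+ n], each column of the powers is an orbit of the scalar recurrences. *)
Lemma amplification_power_bounded :
  (forall b e r : nat -> R[i],
     (forall n, b n.+1 = b n - sigma p xi * e n) ->
     (forall n, e n.+1 = debye_E d a (sigma p xi) (b n) (e n) (r n)) ->
     (forall n, r n.+1 = debye_P d a (e n) (r n)) ->
     [/\ norm_bounded b, norm_bounded e & norm_bounded r]) ->
  bounded_fun (fun n => A ^+ n).
Proof.
move=> H; apply: bounded_fun_mx => i j.
have [] := H (fun n => (A ^+ n) 0 j) (fun n => (A ^+ n) 1 j)
             (fun n => (A ^+ n) 2 j).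
- by move=> n; have [] := amplification_orbit j n.
- by move=> n; have [] := amplification_orbit j n.
- by move=> n; have [] := amplification_orbit j n.
move=> h0 h1 h2; case: i => -[|[|[|//]]] i_lt.
- by rewrite (_ : Ordinal i_lt = 0) //; apply: val_inj.
- by rewrite (_ : Ordinal i_lt = 1) //; apply: val_inj.
- by rewrite (_ : Ordinal i_lt = 2) //; apply: val_inj.
Qed.

End AmplificationOrbits.

Theorem mainTheorem2 (R : realType) (p : params R)
  (eps0_gt0 : 0 < eps0 p) (mu0_gt0 : 0 < mu0 p) (eps_inf_gt0 : 0 < eps_inf p)
  (t_r_gt0 : 0 < t_r p) (dt_gt0 : 0 < dt p) (dx_gt0 : 0 < dx p)
  (eps_inf_le : eps_inf p <= eps_s p) :
  (eps_inf p < eps_s p ->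
     dt p <= Num.min (dx p / c_inf p) (2 * t_r p) ->
     von_neumann_stable p)
  /\
  (eps_s p = eps_inf p ->
     dt p < dx p / c_inf p ->
     von_neumann_stable p).
Proof.
have c_gt0 : 0 < c_inf p by rewrite /c_inf divr_gt0 ?sqrtr_gt0 ?mulr_gt0.
have lam_ge0 : 0 <= lam p by rewrite /lam divr_ge0 1?mulr_ge0 ?ltW.
have del_gt0 : 0 < (del p)%:C%C by rewrite ltcR /del divr_gt0 ?mulr_gt0.
split=> [eps_lt | eps_eq].
  rewrite le_min => /andP[dt_dx dt_tr] xi.
  apply: amplification_power_bounded => b e r; apply: debye_orbit_bounded => //.
  (* The two bounds in the minimum mean delta <= 1 and lambda <= 1. *)
  - by rewrite lecR /del ler_pdivrMr ?mulr_gt0 // mul1r.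
  - by rewrite ltcR /alp subr_gt0 ltr_pdivlMr // mul1r.
  - rewrite (le_trans (sigma_norm_le xi lam_ge0)) // ler_piMr // exprn_ile1 ?ler0c //.
    by rewrite lecR /lam ler_pdivrMr // mul1r mulrC -ler_pdivlMr.
move=> dt_dx xi; apply: amplification_power_bounded => b e r.
have -> : (alp p)%:C%C = 0 by rewrite /alp eps_eq divff ?gt_eqF // subrr.
apply: debye0_orbit_bounded => //.
rewrite (le_lt_trans (sigma_norm_le xi lam_ge0)) // gtr_pMr // exprn_ilt1 ?ler0c //.
by rewrite ltcR /lam ltr_pdivrMr // mul1r mulrC -ltr_pdivlMr.
Qed.
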